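(* Let $f:[\theta_1,\theta_2]\to\mathbb{R}$ be a differentiable function on $(\theta_1,\theta_2)$ with $\theta_1<\theta_2$ and $f'\in L_1[\theta_1,\theta_2]$. If $|f'|$ is a convex function, then the following inequality for Atangana-Baleanu fractional integral operators holds: $$\Bigg|\frac{2(\theta_2-\theta_1)^{\alpha}+(1-\alpha)2^{\alpha+1}\Gamma(\alpha)}{(\theta_2-\theta_1)^{\alpha+1}}\left[f(\theta_1)+f(\theta_2)+2f\left(\tfrac{\theta_1+\theta_2}{2}\right)\right]$$ $$-\frac{2^{\alpha+1}B(\alpha)\Gamma(\alpha)}{(\theta_2-\theta_1)^{\alpha+1}}\left[\left({}^{AB}I^{\alpha}_{\frac{\theta_1+\theta_2}{2}}f\right)(\theta_1)+\left({}^{AB}_{\theta_1}I^{\alpha}f\right)\left(\tfrac{\theta_1+\theta_2}{2}\right)+\left({}^{AB}_{\frac{\theta_1+\theta_2}{2}}I^{\alpha}f\right)(\theta_2)+\left({}^{AB}I^{\alpha}_{\theta_2}f\right)\left(\tfrac{\theta_1+\theta_2}{2}\right)\right]\Bigg|$$ $$\le\frac{2\left[|f'(\theta_1)|+|f'(\theta_2)|\right]}{\alpha+1},$$ where $\alpha\in[0,1]$ and $B(\alpha)$ is a normalization function.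
   Context: $\Gamma$ is the Gamma function and $B(\alpha)$ is the normalization function appearing in the Atangana-Baleanu operators. The left and right Atangana-Baleanu fractional integrals of order $\alpha\in[0,1]$ with base points $a$ and $b$ are, respectively, $$\left({}^{AB}_{a}I^{\alpha}f\right)(t)=\frac{1-\alpha}{B(\alpha)}f(t)+\frac{\alpha}{B(\alpha)\Gamma(\alpha)}\int_a^t f(y)(t-y)^{\alpha-1}\,dy,$$ $$\left({}^{AB}I^{\alpha}_{b}f\right)(t)=\frac{1-\alpha}{B(\alpha)}f(t)+\frac{\alpha}{B(\alpha)\Gamma(\alpha)}\int_t^b f(y)(y-t)^{\alpha-1}\,dy.$$
   Formalization: At α = 0, where Γ(0) is undefined, the left-hand side is read as its limit as α → 0+, shown to exist and satisfy the bound; f'(θ1) and f'(θ2) are the one-sided derivatives of f, assumed to exist. *)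

(* Defs.v *)
From HB Require Import structures.
From mathcomp Require Import all_boot all_order all_algebra.
From mathcomp Require Import all_classical all_reals all_analysis.

Set Implicit Arguments.
Unset Strict Implicit.
Unset Printing Implicit Defensive.

Import Order.TTheory GRing.Theory Num.Theory.
Import numFieldNormedType.Exports.

Local Open Scope classical_set_scope.
Local Open Scope ring_scope.

(* Euler's integral, which converges exactly for z > 0; [Rintegral] returns the
   junk value 0 when it diverges, in particular at z = 0. *)
Definition Gamma (R : realType) (z : R) : R :=
  \int[lebesgue_measure]_(x in `]0, +oo[) (x `^ (z - 1) * expR (- x)).

(* Left integral with base point [a], to be used for a <= t. *)
Definition ABI_left (R : realType) (B : R -> R) (a alpha : R) (f : R -> R)
    (t : R) : R :=
  (1 - alpha) / B alpha * f t
  + alpha / (B alpha * Gamma alpha)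
    * \int[lebesgue_measure]_(y in `[a, t]) (f y * (t - y) `^ (alpha - 1)).

(* Right integral with base point [b], to be used for t <= b. *)
Definition ABI_right (R : realType) (B : R -> R) (b alpha : R) (f : R -> R)
    (t : R) : R :=
  (1 - alpha) / B alpha * f t
  + alpha / (B alpha * Gamma alpha)
    * \int[lebesgue_measure]_(y in `[t, b]) (f y * (y - t) `^ (alpha - 1)).

(* f' is the derivative of f : [a, b] -> R, as a function on [a, b]: the usual
   derivative inside, the one-sided derivative at each endpoint.  The values of
   f and f' outside [a, b] play no role. *)
Definition is_derivative_on (R : realType) (a b : R) (f f' : R -> R) : Prop :=
  [/\ forall x, x \in `]a, b[ -> is_derive x 1 f (f' x),
      h^-1 * (f (a + h) - f a) @[h --> 0^'+] --> f' a &
      h^-1 * (f (b + h) - f b) @[h --> 0^'-] --> f' b].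

(* Main.v *)
Require Import Defs.
From HB Require Import structures.
From mathcomp Require Import all_boot all_order all_algebra.
From mathcomp Require Import all_classical all_reals all_analysis.
From mathcomp Require Import measurable_realfun.
From mathcomp Require Import ring lra.

Set Implicit Arguments.
Unset Strict Implicit.
Unset Printing Implicit Defensive.

Import Order.TTheory GRing.Theory Num.Theory.
Import numFieldNormedType.Exports.

Local Open Scope classical_set_scope.
Local Open Scope ring_scope.

(** Put [h = (theta2 - theta1) / 2] and let [m] be the midpoint.  For
    [0 < a <= 1] the number [Gamma a] is finite and positive, so the factors
    [B a] and [Gamma a] cancel against those inside the four operators, and the
    local terms [(1 - a) / B a * f t] cancel against the [Gamma] part of the
    first summand.  What is left ([lhsE]) is
      [`|h^a (f theta1 + f theta2 + 2 f m) - a (J1 + J2 + J3 + J4)| / h^(a + 1)]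
    where each [J] is the integral over one half of the interval of [f] against
    the weight [d^(a - 1)], [d] being the distance to one end of that half.

    The measure [a d^(a - 1) dy] has total mass [h^a] on its half interval.
    Hence [h^a v - a J] is the integral of [v - f] against that measure, and any
    bound [`|f y - v| <= g + p d + q d^2] integrates exactly, the moments of
    [d] being powers of [h] ([normr_integral_powR_dev]).  This replaces an
    integration by parts against [f']; the derivative enters through the
    increments of [f].  By convexity [`|f'|] lies below its chord, so the mean
    value theorem bounds [`|f y - f x|] by the increment of the quadratic
    primitive of that chord ([normr_sub_le_affine_derive]).

    The four constants [v] have to be [f theta1], [f theta2] and twice [f m],
    but they can be paired with the four integrals in two ways.
    - If [v] is the value of [f] at the end far from the singularity, the
      increments of the quadratic primitive integrate to
      [2 (`|f' theta1| + `|f' theta2|) h^(a + 1) / (a + 1)] in total, since the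
      quadratic contributions cancel by symmetry; this is the stated bound
      ([lhs_le]).
    - If [v] is the value at the singularity, the Lipschitz bound on [f] gives a
      total of order [a] ([lhs_le_small]), so that the left-hand side tends to
      [0] when [a] tends to [0] from the right. *)

(** * Moments of the distance to an end of an interval *)

(** The integrand may blow up at both ends: on the segments
    from [a + d n] to [b - d n] exhausting the interval the usual fundamental
    theorem applies, monotone convergence passes to the limit on the left-hand
    side, and the one-sided continuity of [F] on the right-hand side. *)
Lemma ge0_integral_derive_oo (R : realType) (f F : R -> R) (a b : R) :
  a < b -> {in `]a, b[, forall x, 0 <= f x} -> {in `]a, b[, continuous f} ->
  derivable_oo_LRcontinuous F a b -> {in `]a, b[, F^`()%classic =1 f} ->
  (\int[lebesgue_measure]_(x in `]a, b[) (f x)%:E = (F b - F a)%:E)%E.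
Proof.
move=> ab f0 cf [dF Fa Fb] F'f.
(* Denominators start at 3 so that the segment with index 0 is nondegenerate. *)
pose d (n : nat) := (b - a) * n.+3%:R^-1.
have d0 n : 0 < d n by rewrite mulr_gt0 ?subr_gt0// invr_gt0.
have d2 n : d n + d n < b - a.
  rewrite /d -mulrDr -[ltRHS]mulr1 ltr_pM2l ?subr_gt0//.
  have : n.+3%:R^-1 <= (3 : R)^-1 by rewrite lef_pV2 ?posrE// ler_nat.
  by move: (_^-1) => u ?; lra.
have ddec m n : (m <= n)%N -> d n <= d m.
  move=> mn; rewrite ler_pM2l ?subr_gt0//.
  by rewrite lef_pV2 ?posrE// ler_nat.
have dcvg : d n @[n --> \oo] --> (0 : R).
  rewrite -(mulr0 (b - a)); apply: cvgMr.
  have := @cvg_harmonic R; rewrite -(cvg_shiftn 2) /=.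
  by under eq_cvg do rewrite /harmonic /= addn2.
pose E n : set R := `[a + d n, b - d n]%classic.
have subE n : E n `<=` `]a, b[.
  move=> x; rewrite /E /= !in_itv/= => /andP[h1 h2].
  by have := d0 n; move=> ?; apply/andP; split; lra.
have bigE : \bigcup_n E n = `]a, b[%classic.
  apply/seteqP; split=> [x [n _ /subE]//|x].
  rewrite /= in_itv/= => /andP[ax xb].
  have e0 : 0 < Num.min (x - a) (b - x) by rewrite lt_min !subr_gt0 ax xb.
  have /cvgrPdist_lt/(_ _ e0) [N _ /(_ N (leqnn _))] := dcvg.
  rewrite sub0r normrN gtr0_norm ?d0// lt_min => /andP[h1 h2].
  by exists N => //; rewrite /E/= in_itv/=; apply/andP; split; lra.
have cfE n : {within E n, continuous f}.
  apply: (@continuous_subspaceW _ _ _ `]a, b[%classic); first exact: subE.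
  rewrite continuous_open_subspace; last exact: interval_open.
  by move=> x; rewrite inE; exact: cf.
have IE n : (\int[lebesgue_measure]_(x in E n) (f x)%:E
     = (F (b - d n) - F (a + d n))%:E)%E.
  have En : a + d n < b - d n by have := d2 n; move=> ?; lra.
  have inE' x : x \in `](a + d n), (b - d n)[ -> x \in `]a, b[.
    rewrite !in_itv/= => /andP[? ?]; have ? := d0 n.
    by apply/andP; split; lra.
  have dn0 := d0 n; have dn2 := d2 n.
  rewrite (@continuous_FTC2 _ f F _ _ En (cfE n)) //.
  - have cF x : x \in `]a, b[ -> {for x, continuous F}.
      by move=> /dF /derivable1_diffP /differentiable_continuous.
    split => [x /inE'/dF//||].
    + apply: cvg_at_right_filter; apply: cF; rewrite in_itv/=.
      by apply/andP; split; lra.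
    + apply: cvg_at_left_filter; apply: cF; rewrite in_itv/=.
      by apply/andP; split; lra.
  - by move=> x /inE' /F'f.
have mfE n : measurable_fun (E n) f.
  apply: subspace_continuous_measurable_fun; first exact: measurable_itv.
  exact: cfE.
have ndE : nondecreasing_seq E.
  move=> m n mn; apply/subsetPset => x; rewrite /E/= !in_itv/= => /andP[? ?].
  by have := ddec _ _ mn; move=> ?; apply/andP; split; lra.
have Icvg : (\int[lebesgue_measure]_(x in E i) (f x)%:E)%E @[i --> \oo]
    --> (\int[lebesgue_measure]_(x in `]a, b[) (f x)%:E)%E.
  rewrite -bigE; apply: ge0_nondecreasing_set_cvg_integral => //.
  - by move=> n; exact: measurable_itv.
  - by move=> n; apply/measurable_EFinP; exact: mfE.
  - by move=> n x /subE xab; rewrite lee_fin; exact: f0.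
rewrite -(cvg_lim _ Icvg)//; apply/cvg_lim => //; under eq_cvg do rewrite IE.
apply: cvg_EFin; first exact: nearW.
apply: cvgB.
- have /(cvg_at_leftP F b (F b)).1 := Fb; apply; split=> [n|].
    by rewrite gtrBl.
  by rewrite -[X in _ --> X]subr0; apply: cvgB => //; exact: cvg_cst.
- have /(cvg_at_rightP F a (F a)).1 := Fa; apply; split=> [n|].
    by rewrite ltrDl.
  by rewrite -[X in _ --> X]addr0; apply: cvgD => //; exact: cvg_cst.
Qed.

Lemma continuous_powR_gt0 (R : realType) (b x : R) : 0 < x ->
  {for x, continuous (fun y : R => y `^ b)}.
Proof.
move=> x0; apply/differentiable_continuous/derivable1_diffP.
by apply: derivable_powR; rewrite in_itv/= andbT.
Qed.

Lemma integral_powR_subr (R : realType) (c h b : R) : 0 < h -> 0 < b ->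
  (\int[lebesgue_measure]_(y in `[c, (c + h)%R]) ((y - c) `^ (b - 1))%:E
   = (h `^ b / b)%:E)%E.
Proof.
move=> h0 b0.
have mw D : measurable_fun D (fun y : R => ((y - c) `^ (b - 1))%:E).
  apply/measurable_funTS/measurable_EFinP.
  apply: (measurableT_comp (measurable_powR _)).
  exact: measurable_funB.
rewrite -integral_itv_obnd_cbnd// -integral_itv_bndo_bndc//.
have dF y : c < y ->
    is_derive y 1 (fun x => b^-1 * (x - c) `^ b) ((y - c) `^ (b - 1)).
  move=> cy; have yc : 0 < y - c by rewrite subr_gt0.
  have H := is_derive1_powR b yc.
  have cD : is_derive y 1 (fun x => x - c) 1.
    by rewrite -[X in is_derive _ _ _ X]subr0; apply: is_deriveB.
  have HZ := is_deriveZ b^-1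
    (@is_derive1_comp _ (fun x => x `^ b) (fun x => x - c) _ _ _ H cD).
  apply: (is_derive_eq HZ).
  by rewrite /GRing.scale/= mulr1 mulKf// gt_eqF.
rewrite (@ge0_integral_derive_oo _ _ (fun x => b^-1 * (x - c) `^ b)).
- by rewrite subrr powR0 ?gt_eqF// mulr0 subr0 addrAC subrr add0r mulrC.
- by rewrite ltrDl.
- by move=> x _; exact: powR_ge0.
- move=> x; rewrite in_itv/= => /andP[cx _].
  apply: (@continuous_comp _ _ _ (fun y => y - c) (fun y => y `^ (b - 1))).
    exact: differentiable_continuous.
  by apply: continuous_powR_gt0; rewrite subr_gt0.
- split.
  + by move=> x; rewrite in_itv/= => /andP[/dF cx _]; exact: ex_derive.
  + rewrite subrr powR0 ?gt_eqF// mulr0 -(mulr0 b^-1); apply: cvgMr.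
    apply/cvg_at_rightP => u [uc ucvg].
    have /cvg_at_rightP := powR_cvg0 b0; apply; split=> [n|].
      by rewrite subr_gt0.
    by rewrite -(subrr c); apply: cvgB => //; exact: cvg_cst.
  + apply: cvg_at_left_filter.
    have cc : c < c + h by rewrite ltrDl.
    suff : {for c + h, continuous (fun x => b^-1 * (x - c) `^ b)} by [].
    apply/differentiable_continuous/derivable1_diffP.
    by have [] := dF _ cc.
- move=> x; rewrite in_itv/= => /andP[/dF cx _].
  by rewrite derive1E; exact: derive_val.
Qed.

Lemma integral_powR_subl (R : realType) (c h b : R) : 0 < h -> 0 < b ->
  (\int[lebesgue_measure]_(y in `[(c - h)%R, c]) ((c - y) `^ (b - 1))%:E
   = (h `^ b / b)%:E)%E.
Proof.
move=> h0 b0.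
have mw D : measurable_fun D (fun y : R => ((c - y) `^ (b - 1))%:E).
  apply/measurable_funTS/measurable_EFinP.
  apply: (measurableT_comp (measurable_powR _)).
  exact: measurable_funB.
rewrite -integral_itv_obnd_cbnd// -integral_itv_bndo_bndc//.
have dF y : y < c ->
    is_derive y 1 (fun x => - b^-1 * (c - x) `^ b) ((c - y) `^ (b - 1)).
  move=> cy; have yc : 0 < c - y by rewrite subr_gt0.
  have H := is_derive1_powR b yc.
  have cD : is_derive y 1 (fun x => c - x) (-1).
    by rewrite -[X in is_derive _ _ _ X]sub0r; apply: is_deriveB.
  have HZ := is_deriveZ (- b^-1)
    (@is_derive1_comp _ (fun x => x `^ b) (fun x => c - x) _ _ _ H cD).
  apply: (is_derive_eq HZ).
  by rewrite /GRing.scale/= mulrN1 mulrNN mulKf// gt_eqF.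
rewrite (@ge0_integral_derive_oo _ _ (fun x => - b^-1 * (c - x) `^ b)).
- rewrite subrr powR0 ?gt_eqF// mulr0 sub0r mulNr opprK mulrC.
  by rewrite opprB addrC subrK.
- by rewrite gtrBl.
- by move=> x _; exact: powR_ge0.
- move=> x; rewrite in_itv/= => /andP[_ cx].
  apply: (@continuous_comp _ _ _ (fun y => c - y) (fun y => y `^ (b - 1))).
    exact: differentiable_continuous.
  by apply: continuous_powR_gt0; rewrite subr_gt0.
- split.
  + by move=> x; rewrite in_itv/= => /andP[_ /dF cx]; exact: ex_derive.
  + apply: cvg_at_right_filter.
    have cc : c - h < c by rewrite gtrBl.
    suff : {for c - h, continuous (fun x => - b^-1 * (c - x) `^ b)} by [].
    apply/differentiable_continuous/derivable1_diffP.
    by have [] := dF _ cc.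
  + rewrite subrr powR0 ?gt_eqF// mulr0 -(mulr0 (- b^-1)); apply: cvgMr.
    apply/cvg_at_leftP => u [uc ucvg].
    have /cvg_at_rightP := powR_cvg0 b0; apply; split=> [n|].
      by rewrite subr_gt0.
    by rewrite -(subrr c); apply: cvgB => //; exact: cvg_cst.
- move=> x; rewrite in_itv/= => /andP[_ /dF cx].
  by rewrite derive1E; exact: derive_val.
Qed.

(** * Positivity of the Gamma function on ]0, 1] *)

Lemma ge0_le_integral_EFin (R : realType) (D : set R) (u w : R -> R) :
  measurable D -> measurable_fun D u -> measurable_fun D w ->
  (forall x, D x -> 0 <= u x <= w x) ->
  (\int[lebesgue_measure]_(x in D) (u x)%:E
   <= \int[lebesgue_measure]_(x in D) (w x)%:E)%E.
Proof.
move=> mD mu mw uw; apply: ge0_le_integral => //.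
all: try by apply/measurable_EFinP.
all: by move=> x /uw/andP[u0 uwx]; rewrite lee_fin // (le_trans u0).
Qed.

(** [Gamma] is a real-valued integral, equal to [0] on divergence, so positivity
    carries convergence with it.  The integrand is below [x^(a - 1)] on ]0, 1]
    and below [exp (- x)], the exponential density of rate 1, beyond; on
    ]0, 1] it is at least [exp (-1)]. *)
Lemma Gamma_gt0 (R : realType) (a : R) : 0 < a <= 1 -> 0 < Gamma a.
Proof.
move=> /andP[a0 a1].
pose g (x : R) : R := x `^ (a - 1) * expR (- x).
have g0 x : 0 <= g x by rewrite mulr_ge0 ?powR_ge0 ?expR_ge0.
have mg D : measurable_fun D g.
  apply/measurable_funTS/measurable_funM; first exact: measurable_powR.
  by apply: measurableT_comp => //; exact: measurable_expR.
have mpow D : measurable_fun D (fun x : R => x `^ (a - 1)).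
  by apply/measurable_funTS; exact: measurable_powR.
have mexp D : measurable_fun D (@exponential_pdf R 1).
  by apply/measurable_funTS; exact: measurable_exponential_pdf.
have near0 : (\int[lebesgue_measure]_(x in `]0%R, 1%R]) (g x)%:E
    <= (a^-1)%:E)%E.
  have <- : (\int[lebesgue_measure]_(x in `]0%R, 1%R]) (x `^ (a - 1))%:E
      = (a^-1)%:E)%E.
    have := @integral_powR_subr R 0 1 a ltr01 a0.
    rewrite add0r powR1 mul1r => <-; rewrite integral_itv_obnd_cbnd; last first.
      by apply/measurable_EFinP; exact: mpow.
    by apply: eq_integral => x _; rewrite subr0.
  apply: ge0_le_integral_EFin => // x; rewrite /= in_itv/= => /andP[x0 _].
  by rewrite g0/= ler_piMr ?powR_ge0// -expR0 ler_expR oppr_le0 ltW.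
have nearoo : (\int[lebesgue_measure]_(x in `]1%R, +oo[) (g x)%:E <= 1)%E.
  rewrite -(@integral_exponential_pdf R 1 ltr01).
  apply: (@le_trans _ _ (\int[lebesgue_measure]_(x in `]1%R, +oo[)
      (exponential_pdf 1 x)%:E)%E); last first.
    apply: ge0_subset_integral => //.
      by apply/measurable_EFinP; exact: mexp.
    by move=> x _; rewrite lee_fin; apply: exponential_pdf_ge0.
  apply: ge0_le_integral_EFin => //.
  move=> x; rewrite /= in_itv/= andbT => x1; rewrite g0/=.
  rewrite exponential_pdfE; last by rewrite ltW// (lt_trans _ x1).
  rewrite mul1r mulN1r /g.
  rewrite ler_piMl ?expR_ge0// -[leRHS](powRr0 x).
  by apply: ler_powR; rewrite ?subr_le0// ltW.
have splitoo : `]0%R, +oo[%classic = `]0%R, 1%R] `|` `]1%R, +oo[ :> set R.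
  by rewrite -itv_bndbnd_setU// bnd_simp.
rewrite /Gamma /Rintegral fine_gt0//; apply/andP; split.
  apply: (@lt_le_trans _ _ (expR (-1))%:E); first by rewrite lte_fin expR_gt0.
  apply: (@le_trans _ _ (\int[lebesgue_measure]_(x in `]0%R, 1%R]) (g x)%:E)%E).
    have <- : (\int[@lebesgue_measure R]_(x in `]0%R, 1%R])
        cst (expR (-1 : R))%:E x = (expR (-1))%:E)%E.
      rewrite integral_cst//= lebesgue_measure_itv/= lte_fin ltr01.
      by rewrite oppr0 adde0 mule1.
    apply: ge0_le_integral_EFin => // x; rewrite /= in_itv/= => /andP[x0 x1].
    rewrite expR_ge0/= -[leLHS]mul1r ler_pM ?expR_ge0 ?ler_expR ?lerN2//.
    rewrite -[leLHS](powRr0 x).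
    by apply: ger_powR; rewrite ?subr_le0// x0.
  apply: ge0_subset_integral => //.
  - by apply/measurable_EFinP; exact: mg.
  - by move=> x _; rewrite lee_fin; exact: g0.
  - by rewrite splitoo; exact: subsetUl.
rewrite splitoo ge0_integral_setU => //.
- by rewrite (le_lt_trans (leeD near0 nearoo))// -EFinD ltry.
- by apply/measurable_EFinP; exact: mg.
- by move=> x _; rewrite lee_fin; exact: g0.
- apply/disj_setPLR => x/=; rewrite !in_itv/= andbT => /andP[_ x1].
  by apply/negP; rewrite -leNgt.
Qed.

(** * Integrals against a power weight *)

(** The function [d] is a distance to one end of an interval [D] of length [h];
    stating its moments as a hypothesis treats both ends at once.  With [b = a]
    it says that [a d^(a - 1)] has mass [h^a], which turns the quantity to bound
    into the integral of [v - F] against this weight; with [b = a + 1] and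
    [b = a + 2] it evaluates the bound. *)
Lemma normr_integral_powR_dev (R : realType) (D : set R) (d F : R -> R)
    (a h v g p q : R) :
  measurable D -> (forall y, D y -> 0 <= d y) -> measurable_fun D d ->
  measurable_fun D F -> 0 < a ->
  (forall b, 0 < b ->
    (\int[lebesgue_measure]_(y in D) (d y `^ (b - 1))%:E
     = (h `^ b / b)%:E)%E) ->
  (forall y, D y -> `|F y - v| <= g + p * d y + q * d y ^+ 2) ->
  `|h `^ a * v - a * \int[lebesgue_measure]_(y in D) (F y * d y `^ (a - 1))|
    <= g * h `^ a + p * (a * h `^ (a + 1) / (a + 1))
       + q * (a * h `^ (a + 2) / (a + 2)).
Proof.
move=> mD d0 md mF a0 mom Fv.
have mpow b : measurable_fun D (fun y => d y `^ b).
  exact: (measurableT_comp (measurable_powR _)).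
have iw b : 0 < b ->
    lebesgue_measure.-integrable D (EFin \o (fun y => d y `^ (b - 1))).
  move=> b0; apply/integrableP; split.
    by apply/measurable_EFinP; exact: mpow.
  under eq_integral do rewrite /= ger0_norm ?powR_ge0//.
  by rewrite mom// ltry.
have Iw b : 0 < b ->
    \int[lebesgue_measure]_(y in D) (d y `^ (b - 1)) = h `^ b / b.
  by move=> b0; rewrite /Rintegral mom.
have a10 : 0 < a + 1 by rewrite addr_gt0.
have a20 : 0 < a + 2 by rewrite addr_gt0.
have iZ r b : 0 < b ->
    lebesgue_measure.-integrable D (EFin \o (fun y => r * d y `^ (b - 1))).
  by move=> b0; have := @integrableZl _ _ _ lebesgue_measure D mD r _ (iw _ b0).
(* Q is the quadratic bound times the weight, written as a sum of moments. *)
pose Q y := g * d y `^ (a - 1) + p * d y `^ (a + 1 - 1)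
  + q * d y `^ (a + 2 - 1).
have iQ2 : lebesgue_measure.-integrable D
    (EFin \o (fun y => g * d y `^ (a - 1) + p * d y `^ (a + 1 - 1))).
  by have := @integrableD _ _ _ lebesgue_measure D mD _ _
    (iZ g _ a0) (iZ p _ a10).
have iQ : lebesgue_measure.-integrable D (EFin \o Q).
  by have := @integrableD _ _ _ lebesgue_measure D mD _ _ iQ2 (iZ q _ a20).
have IQ : \int[lebesgue_measure]_(y in D) Q y
    = g * (h `^ a / a) + p * (h `^ (a + 1) / (a + 1))
      + q * (h `^ (a + 2) / (a + 2)).
  rewrite RintegralD//; last exact: iZ.
  rewrite RintegralD//; [|exact: iZ..].
  by rewrite !RintegralZl ?Iw//; exact: iw.
have FQ y : D y -> `|(F y - v) * d y `^ (a - 1)| <= Q y.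
  move=> Dy; rewrite normrM (ger0_norm (powR_ge0 _ _)).
  have -> : Q y = (g + p * d y + q * d y ^+ 2) * d y `^ (a - 1).
    have E1 : d y `^ (a + 1 - 1) = d y * d y `^ (a - 1).
      by rewrite mulr_powRB1 ?d0// addrK.
    have E2 : d y `^ (a + 2 - 1) = d y * (d y * d y `^ (a - 1)).
      by rewrite -E1 mulr_powRB1 ?d0//; congr (_ `^ _); ring.
    by rewrite /Q E1 E2; ring.
  by rewrite ler_wpM2r ?powR_ge0// Fv.
have idev : lebesgue_measure.-integrable D
    (EFin \o (fun y => (F y - v) * d y `^ (a - 1))).
  apply: (@le_integrable _ _ _ lebesgue_measure D mD _ _ _ _ iQ).
    apply/measurable_EFinP/measurable_funM; last exact: mpow.
    by apply: measurable_funB.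
  move=> y Dy /=; rewrite lee_fin (le_trans (FQ y Dy))//; exact: ler_norm.
have Fdev : \int[lebesgue_measure]_(y in D) (F y * d y `^ (a - 1))
    = \int[lebesgue_measure]_(y in D) ((F y - v) * d y `^ (a - 1))
      + v * (h `^ a / a).
  rewrite -Iw// -RintegralZl//; last exact: iw.
  rewrite -RintegralD//; last exact: iZ.
  by apply: eq_Rintegral => y _; ring.
have -> : h `^ a * v
      - a * \int[lebesgue_measure]_(y in D) (F y * d y `^ (a - 1))
    = - (a * \int[lebesgue_measure]_(y in D) ((F y - v) * d y `^ (a - 1))).
  by rewrite Fdev; field; rewrite gt_eqF.
rewrite normrN normrM gtr0_norm//.
apply: (@le_trans _ _ (a * \int[lebesgue_measure]_(y in D) Q y)).
  rewrite ler_pM2l// (le_trans (le_normr_Rintegral _ _))//.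
  apply: le_Rintegral => //.
  by have := integrable_norm idev.
by rewrite IQ le_eqVlt; apply/orP; left; apply/eqP; field; rewrite !gt_eqF.
Qed.

(** * Increments of a function with a bounded derivative *)

Lemma within_continuous_is_derivative_on (R : realType) (a b : R)
    (f f' : R -> R) :
  a < b -> is_derivative_on a b f f' -> {within `[a, b], continuous f}.
Proof.
move=> ab [df fa fb].
(* At the endpoints, f u = f c + (u - c) * q where the quotient q converges. *)
have quot (c : R) (u : R^nat) : u n @[n --> \oo] --> c ->
    (forall n, u n != c) ->
    (u n - c)^-1 * (f (c + (u n - c)) - f c) @[n --> \oo] --> f' c ->
    f (u n) @[n --> \oo] --> f c.
  move=> uc neq q; have u0 : u n - c @[n --> \oo] --> (0 : R).
    by rewrite -(subrr c); apply: cvgB => //; exact: cvg_cst.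
  have -> : (fun n => f (u n)) = (fun n => f c
      + (u n - c) * ((u n - c)^-1 * (f (c + (u n - c)) - f c))).
    apply/funext => n; rewrite mulVKf ?subr_eq0 ?neq//.
    by rewrite [c + _]addrC subrK addrC subrK.
  rewrite -[X in _ --> X]addr0 -[X in _ + X](mul0r (f' c)).
  by apply: cvgD; [exact: cvg_cst|exact: cvgM].
apply/(continuous_within_itvP _ ab); split.
- move=> x /df[dfx _].
  exact/differentiable_continuous/derivable1_diffP.
- apply/cvg_at_rightP => u [au ucvg]; apply: quot => //.
    by move=> n; rewrite gt_eqF.
  move/cvg_at_rightP : fa => /(_ (fun n => u n - a)); apply; split.
    by move=> n; rewrite subr_gt0.
  by rewrite -(subrr a); apply: cvgB => //; exact: cvg_cst.
- apply/cvg_at_leftP => u [au ucvg]; apply: quot => //.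
    by move=> n; rewrite lt_eqF.
  move/cvg_at_leftP : fb => /(_ (fun n => u n - b)); apply; split.
    by move=> n; rewrite subr_lt0.
  by rewrite -(subrr b); apply: cvgB => //; exact: cvg_cst.
Qed.

Lemma convex_function_le_chord (R : realType) (a b : R) (g : R -> R) :
  a < b -> convex_function (`[a, b] : set R^o) g ->
  forall x, a <= x <= b -> g x <= g a + (g b - g a) / (b - a) * (x - a).
Proof.
move=> ab cg x /andP[ax xb].
have ba0 : 0 < b - a by rewrite subr_gt0.
(* t is the weight of a in x = t a + (1 - t) b. *)
pose t := (b - x) / (b - a).
have t0 : 0 <= t by rewrite divr_ge0 ?subr_ge0// ltW.
have t1 : t <= 1 by rewrite ler_pdivrMr// mul1r lerD2l lerN2.
have aab : (a : convex_lmodType R^o) \in (`[a, b]%classic : set R^o).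
  by rewrite inE/= in_itv/= lexx ltW.
have bab : (b : convex_lmodType R^o) \in (`[a, b]%classic : set R^o).
  by rewrite inE/= in_itv/= lexx ltW.
have := cg (Itv01 t0 t1) a b aab bab.
have -> : conv (Itv01 t0 t1) (a : convex_lmodType R^o) b = x.
  rewrite [LHS]convRE /= /unstable.onem /t; field.
  by rewrite gt_eqF.
rewrite [X in _ <= X]convRE /= /unstable.onem => /le_trans; apply.
rewrite le_eqVlt; apply/orP; left; apply/eqP; rewrite /t; field.
by rewrite gt_eqF.
Qed.

(** The right-hand side is the increment of a primitive [G] of the bound on
    [`|f'|].  Both [G - f] and [G + f] have nonnegative derivative, hence are
    nondecreasing. *)
Lemma normr_sub_le_affine_derive (R : realType) (a b : R)
    (f f' : R -> R) (p q : R) :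
  a < b -> is_derivative_on a b f f' ->
  (forall x, a <= x <= b -> `|f' x| <= p + q * (x - a)) ->
  forall x y, a <= x -> x <= y -> y <= b ->
  `|f y - f x| <= p * (y - x) + q / 2 * ((y - a) ^+ 2 - (x - a) ^+ 2).
Proof.
move=> ab hf le_f' x y ax xy yb.
have cf := within_continuous_is_derivative_on ab hf.
case: (hf) => df _ _.
move: xy; rewrite le_eqVlt => /predU1P[->|xy].
  by rewrite !subrr !mulr0 addr0 normr0.
pose G (t : R) : R := p * (t - a) + q / 2 * (t - a) ^+ 2.
have dG (t : R) : is_derive t 1 G (p + q * (t - a)).
  have d1 : is_derive t 1 (fun u => u - a) 1.
    by rewrite -[X in is_derive _ _ _ X]subr0; apply: is_deriveB.
  have dG2 := is_deriveD (is_deriveZ p d1)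
    (is_deriveZ (q / 2) (is_deriveM d1 d1)).
  apply: (is_derive_eq dG2); rewrite /GRing.scale/=.
  by field.
(* The sign e covers G - f and G + f together. *)
have main (e : R) : `|e| = 1 -> e * (f y - f x) <= G y - G x.
  move=> e1.
  pose H (t : R) : R := G t - e * f t.
  have dH z : z \in `]x, y[ -> is_derive z 1 H (p + q * (z - a) - e * f' z).
    rewrite in_itv/= => /andP[xz zy].
    have dft : is_derive z 1 f (f' z).
      by apply: df; rewrite in_itv/=; apply/andP; split; lra.
    exact: (@is_deriveB R R R G (fun u => e * f u) z 1 _ _ (dG z)
      (@is_deriveZ R R R f e z 1 _ dft)).
  have cH : {within `[x, y], continuous H}.
    apply: (@continuous_subspaceW _ _ _ `[a, b]%classic).
      exact: subset_itvScc.
    have cG : {within `[a, b], continuous G}.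
      apply: continuous_subspaceT => t.
      by apply/differentiable_continuous/derivable1_diffP; case: (dG t).
    move=> t; apply: cvgB; first exact: cG.
    by apply: cvgMr; exact: cf.
  have [c] := MVT xy dH cH.
  rewrite in_itv/= => /andP[xc cy] E.
  have : 0 <= p + q * (c - a) - e * f' c.
    rewrite subr_ge0; apply: le_trans (le_f' c _); last first.
      by apply/andP; split; lra.
    by apply: (le_trans (ler_norm _)); rewrite normrM e1 mul1r.
  have yx : 0 <= y - x by rewrite subr_ge0 ltW.
  move=> /mulr_ge0 /(_ yx); rewrite -E /H; lra.
have H1 := main 1 (normr1 _).
have H2 : (-1) * (f y - f x) <= G y - G x by apply: main; rewrite normrN normr1.
have -> : p * (y - x) + q / 2 * ((y - a) ^+ 2 - (x - a) ^+ 2) = G y - G x.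
  by rewrite /G; ring.
by rewrite ler_norml; apply/andP; split; lra.
Qed.

(** * The two bounds on the left-hand side *)

(** The cancellation of the normalization, with [X = 2^a] and [Y = h^a]. *)
Lemma normalization_cancel (R : realFieldType)
    (a h X Y Bv G v1 v2 v3 J1 J2 J3 J4 : R) :
  h != 0 -> X != 0 -> Y != 0 -> Bv != 0 -> G != 0 ->
  (2 * (X * Y) + (1 - a) * (2 * X) * G) / (2 * X * (h * Y)) * (v1 + v3 + 2 * v2)
  - 2 * X * Bv * G / (2 * X * (h * Y))
    * ((1 - a) / Bv * v1 + a / (Bv * G) * J1
       + ((1 - a) / Bv * v2 + a / (Bv * G) * J2)
       + ((1 - a) / Bv * v3 + a / (Bv * G) * J3)
       + ((1 - a) / Bv * v2 + a / (Bv * G) * J4))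
  = (Y * (v1 + v3 + 2 * v2) - a * (J1 + J2 + J3 + J4)) / (h * Y).
Proof.
by move=> h0 X0 Y0 B0 G0; field; rewrite h0 X0 Y0 B0 G0.
Qed.

Section midpoint_defect.
Variables (R : realType) (B : R -> R).
Variables (theta1 theta2 : R) (f f' : R -> R).
Hypothesis hB : forall a, 0 <= a <= 1 -> B a != 0.
Hypothesis htheta : theta1 < theta2.
Hypothesis hf : is_derivative_on theta1 theta2 f f'.
Hypothesis hconv :
  convex_function (`[theta1, theta2] : set R^o) (fun x => `|f' x|).

Let m := (theta1 + theta2) / 2.
Let h := (theta2 - theta1) / 2.
Let A : R := `|f' theta1|.
Let C : R := `|f' theta2|.
Let J1 a :=
  \int[lebesgue_measure]_(y in `[theta1, m]) (f y * (y - theta1) `^ (a - 1)).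
Let J2 a :=
  \int[lebesgue_measure]_(y in `[theta1, m]) (f y * (m - y) `^ (a - 1)).
Let J3 a :=
  \int[lebesgue_measure]_(y in `[m, theta2]) (f y * (theta2 - y) `^ (a - 1)).
Let J4 a :=
  \int[lebesgue_measure]_(y in `[m, theta2]) (f y * (y - m) `^ (a - 1)).
Let lhs := fun a : R =>
    `| (2 * (theta2 - theta1) `^ a + (1 - a) * 2 `^ (a + 1) * Gamma a)
         / (theta2 - theta1) `^ (a + 1)
         * (f theta1 + f theta2 + 2 * f m)
       - 2 `^ (a + 1) * B a * Gamma a / (theta2 - theta1) `^ (a + 1)
         * (ABI_right B m a f theta1 + ABI_left B theta1 a f m
            + ABI_left B m a f theta2 + ABI_right B theta2 a f m) |.

Let h0 : 0 < h. Proof. by rewrite divr_gt0// subr_gt0. Qed.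

Lemma lhsE a : 0 < a <= 1 -> lhs a =
  `| (h `^ a * (f theta1 + f theta2 + 2 * f m)
      - a * (J1 a + J2 a + J3 a + J4 a)) / (h * h `^ a) |.
Proof.
move=> a01; have [a0 a1] := andP a01.
have dE : theta2 - theta1 = 2 * h by rewrite /h; field.
have powS (x : R) : 0 < x -> x `^ (a + 1) = x * x `^ a.
  by move=> x0; rewrite -mulr_powRB1 ?ltW ?addr_gt0// addrK.
rewrite /lhs /ABI_right /ABI_left -/(J1 a) -/(J2 a) -/(J3 a) -/(J4 a) dE.
have h20 : 0 < 2 * h by rewrite mulr_gt0.
rewrite !powS// powRM ?ltW//.
have -> : 2 * h * (2 `^ a * h `^ a) = 2 * 2 `^ a * (h * h `^ a) by ring.
congr `| _ |; apply: normalization_cancel; last 2 first.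
- by rewrite hB// a1 ltW.
- by rewrite gt_eqF ?Gamma_gt0.
all: by rewrite gt_eqF ?powR_gt0.
Qed.

Lemma normr_sub_le_chord x y : theta1 <= x -> x <= y -> y <= theta2 ->
  `|f y - f x| <= A * (y - x)
    + (C - A) / (theta2 - theta1) / 2 * ((y - theta1) ^+ 2 - (x - theta1) ^+ 2).
Proof.
apply: (normr_sub_le_affine_derive htheta hf).
exact: convex_function_le_chord htheta hconv.
Qed.

(** The slope from [x] to [y] of the quadratic primitive is a convex combination
    of its end slopes [A] and [C], hence at most [A + C]. *)
Lemma normr_sub_le_lipschitz x y : theta1 <= x -> x <= y -> y <= theta2 ->
  `|f y - f x| <= (A + C) * (y - x).
Proof.
move=> ax xy yb; apply: (le_trans (normr_sub_le_chord ax xy yb)).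
have A0 : 0 <= A := normr_ge0 _. have C0 : 0 <= C := normr_ge0 _.
have th0 : 0 < theta2 - theta1 by rewrite subr_gt0.
pose s := (x - theta1 + (y - theta1)) / (2 * (theta2 - theta1)).
have s0 : 0 <= s by rewrite divr_ge0//; lra.
have s1 : s <= 1 by rewrite ler_pdivrMr; lra.
have -> : A * (y - x) + (C - A) / (theta2 - theta1) / 2
     * ((y - theta1) ^+ 2 - (x - theta1) ^+ 2)
  = (A * (1 - s) + C * s) * (y - x).
  by rewrite /s; field; rewrite gt_eqF.
rewrite ler_wpM2r ?subr_ge0//.
rewrite lerD//; [rewrite ler_piMr//; lra|by rewrite ler_piMr].
Qed.

Let thm : theta1 < m. Proof. by have := htheta; rewrite /m => ?; lra. Qed.
Let mth : m < theta2. Proof. by have := htheta; rewrite /m => ?; lra. Qed.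

Let mf u v : theta1 <= u -> v <= theta2 -> measurable_fun `[u, v]%classic f.
Proof.
move=> tu vt; apply: (@measurable_funS _ _ _ _ `[theta1, theta2]%classic) => //.
  by apply: subset_itvScc.
apply: subspace_continuous_measurable_fun => //.
exact: within_continuous_is_derivative_on htheta hf.
Qed.

(** The constants [v1], ..., [v4] are left free, because the two bounds below
    pair the values of [f] with the four integrals differently. *)
Lemma normr_four_dev a (v1 v2 v3 v4 g1 p1 q1 g2 p2 q2 g3 p3 q3 g4 p4 q4 : R) :
  0 < a ->
  (forall y, theta1 <= y <= m ->
    `|f y - v1| <= g1 + p1 * (y - theta1) + q1 * (y - theta1) ^+ 2) ->
  (forall y, theta1 <= y <= m ->
    `|f y - v2| <= g2 + p2 * (m - y) + q2 * (m - y) ^+ 2) ->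
  (forall y, m <= y <= theta2 ->
    `|f y - v3| <= g3 + p3 * (theta2 - y) + q3 * (theta2 - y) ^+ 2) ->
  (forall y, m <= y <= theta2 ->
    `|f y - v4| <= g4 + p4 * (y - m) + q4 * (y - m) ^+ 2) ->
  `|h `^ a * (v1 + v2 + v3 + v4) - a * (J1 a + J2 a + J3 a + J4 a)|
   <= (g1 + g2 + g3 + g4) * h `^ a
      + (p1 + p2 + p3 + p4) * (a * h `^ (a + 1) / (a + 1))
      + (q1 + q2 + q3 + q4) * (a * h `^ (a + 2) / (a + 2)).
Proof.
move=> a0 H1 H2 H3 H4.
have mE1 : m = theta1 + h by rewrite /m /h; field.
have mE2 : theta2 = m + h by rewrite /m /h; field.
have mE3 : theta1 = m - h by rewrite /m /h; field.
have mE4 : m = theta2 - h by rewrite /m /h; field.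
have D1 : `|h `^ a * v1 - a * J1 a| <= g1 * h `^ a
    + p1 * (a * h `^ (a + 1) / (a + 1)) + q1 * (a * h `^ (a + 2) / (a + 2)).
  apply: normr_integral_powR_dev => //.
  - by move=> y; rewrite /= in_itv/= subr_ge0 => /andP[].
  - by apply: measurable_funB.
  - by apply: mf; rewrite // ltW.
  - by move=> b b0; rewrite [in X in integral _ X _]mE1 integral_powR_subr.
have D2 : `|h `^ a * v2 - a * J2 a| <= g2 * h `^ a
    + p2 * (a * h `^ (a + 1) / (a + 1)) + q2 * (a * h `^ (a + 2) / (a + 2)).
  apply: normr_integral_powR_dev => //.
  - by move=> y; rewrite /= in_itv/= subr_ge0 => /andP[].
  - by apply: measurable_funB.
  - by apply: mf; rewrite // ltW.
  - by move=> b b0; rewrite [in X in integral _ X _]mE3 integral_powR_subl.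
have D3 : `|h `^ a * v3 - a * J3 a| <= g3 * h `^ a
    + p3 * (a * h `^ (a + 1) / (a + 1)) + q3 * (a * h `^ (a + 2) / (a + 2)).
  apply: normr_integral_powR_dev => //.
  - by move=> y; rewrite /= in_itv/= subr_ge0 => /andP[].
  - by apply: measurable_funB.
  - by apply: mf; rewrite // ltW.
  - by move=> b b0; rewrite [in X in integral _ X _]mE4 integral_powR_subl.
have D4 : `|h `^ a * v4 - a * J4 a| <= g4 * h `^ a
    + p4 * (a * h `^ (a + 1) / (a + 1)) + q4 * (a * h `^ (a + 2) / (a + 2)).
  apply: normr_integral_powR_dev => //.
  - by move=> y; rewrite /= in_itv/= subr_ge0 => /andP[].
  - by apply: measurable_funB.
  - by apply: mf; rewrite // ltW.
  - by move=> b b0; rewrite [in X in integral _ X _]mE2 integral_powR_subr.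
have -> : h `^ a * (v1 + v2 + v3 + v4) - a * (J1 a + J2 a + J3 a + J4 a)
  = (h `^ a * v1 - a * J1 a) + (h `^ a * v2 - a * J2 a)
    + (h `^ a * v3 - a * J3 a) + (h `^ a * v4 - a * J4 a) by ring.
apply: (le_trans (ler_normD _ _)).
apply: le_trans (lerD (le_trans (ler_normD _ _)
  (lerD (le_trans (ler_normD _ _) (lerD D1 D2)) D3)) D4) _.
by rewrite le_eqVlt; apply/orP; left; apply/eqP; ring.
Qed.

(** Each constant is the value of [f] at the end of the half interval far from
    the singularity of the weight, so that [g] is the full increment of the
    quadratic primitive over that half, and [- p d - q d^2] the part of it
    between the singularity and the point.  The four coefficients [q] cancel,
    the four constants [g] add up to [2 (A + C) h], and the four coefficients
    [p] to [- 2 (A + C)]. *)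
Lemma lhs_le a : 0 < a <= 1 -> lhs a <= 2 * (A + C) / (a + 1).
Proof.
move=> a01; rewrite lhsE//; have [a0 a1] := andP a01.
pose k := (C - A) / (theta2 - theta1).
have kh : k * h = (C - A) / 2 by rewrite /k /h; field; rewrite subr_eq0 gt_eqF.
have Y0 : 0 < h `^ a by rewrite powR_gt0.
have hY0 : 0 < h * h `^ a by rewrite mulr_gt0.
rewrite normrM normfV (gtr0_norm hY0) ler_pdivrMr//.
have -> : f theta1 + f theta2 + 2 * f m
  = f m + f theta1 + f m + f theta2 by ring.
have mE : m = theta1 + h by rewrite /m /h; field.
have tE : theta2 = theta1 + 2 * h by rewrite /h; field.
have := @normr_four_dev a (f m) (f theta1) (f m) (f theta2)
  (A * h + k / 2 * h ^+ 2) (- A) (- (k / 2))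
  (A * h + k / 2 * h ^+ 2) (- (A + k * h)) (k / 2)
  (C * h - k / 2 * h ^+ 2) (- C) (k / 2)
  (C * h - k / 2 * h ^+ 2) (- (A + k * h)) (- (k / 2)) a0.
move=> /(_ _ _ _ _)/le_trans; apply.
- move=> y /andP[ty ym]; rewrite distrC.
  have := normr_sub_le_chord ty ym (ltW mth).
  move/le_trans; apply.
  by rewrite -/k mE le_eqVlt; apply/orP; left; apply/eqP; field.
- move=> y /andP[ty ym].
  have := normr_sub_le_chord (lexx _) ty (le_trans ym (ltW mth)).
  move/le_trans; apply.
  by rewrite -/k mE le_eqVlt; apply/orP; left; apply/eqP; field.
- move=> y /andP[my yt].
  have := normr_sub_le_chord (ltW thm) my yt.
  move/le_trans; apply.
  rewrite -/k.
  have -> : C = A + k * (2 * h) by lra.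
  by rewrite tE mE le_eqVlt; apply/orP; left; apply/eqP; field.
- move=> y /andP[my yt]; rewrite distrC.
  have := normr_sub_le_chord (le_trans (ltW thm) my) yt (lexx _).
  move/le_trans; apply.
  rewrite -/k.
  have -> : C = A + k * (2 * h) by lra.
  by rewrite tE mE le_eqVlt; apply/orP; left; apply/eqP; field.
have powS : h `^ (a + 1) = h * h `^ a.
  by rewrite -mulr_powRB1 ?ltW ?addr_gt0// addrK.
rewrite powS le_eqVlt; apply/orP; left; apply/eqP.
have -> : C = A + k * (2 * h) by lra.
by field; rewrite !gt_eqF ?addr_gt0.
Qed.

(** Each constant is the value of [f] at the singularity of the weight, so the
    deviation is at most [(A + C) d]; the moment [a h^(a + 1) / (a + 1)] brings
    the factor [a]. *)
Lemma lhs_le_small a : 0 < a <= 1 -> lhs a <= 4 * (A + C) * a.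
Proof.
move=> a01; rewrite lhsE//; have [a0 a1] := andP a01.
have Y0 : 0 < h `^ a by rewrite powR_gt0.
have hY0 : 0 < h * h `^ a by rewrite mulr_gt0.
rewrite normrM normfV (gtr0_norm hY0) ler_pdivrMr//.
have -> : f theta1 + f theta2 + 2 * f m
  = f theta1 + f m + f theta2 + f m by ring.
have := @normr_four_dev a (f theta1) (f m) (f theta2) (f m)
  0 (A + C) 0 0 (A + C) 0 0 (A + C) 0 0 (A + C) 0 a0.
move=> /(_ _ _ _ _)/le_trans; apply.
- move=> y /andP[ty ym]; rewrite mul0r addr0 add0r.
  by apply: normr_sub_le_lipschitz => //; apply: le_trans ym (ltW mth).
- move=> y /andP[ty ym]; rewrite mul0r addr0 add0r distrC.
  by apply: normr_sub_le_lipschitz => //; exact: ltW.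
- move=> y /andP[my yt]; rewrite mul0r addr0 add0r distrC.
  by apply: normr_sub_le_lipschitz => //; apply: le_trans (ltW thm) my.
- move=> y /andP[my yt]; rewrite mul0r addr0 add0r.
  by apply: normr_sub_le_lipschitz => //; exact: ltW.
have powS : h `^ (a + 1) = h * h `^ a.
  by rewrite -mulr_powRB1 ?ltW ?addr_gt0// addrK.
have AC0 : 0 <= A + C by rewrite addr_ge0 ?normr_ge0.
have -> : (0 + 0 + 0 + 0) * h `^ a
   + (A + C + (A + C) + (A + C) + (A + C)) * (a * h `^ (a + 1) / (a + 1))
   + (0 + 0 + 0 + 0) * (a * h `^ (a + 2) / (a + 2))
   = (4 * (A + C) * a * (h * h `^ a)) / (a + 1).
  by rewrite powS; ring.
rewrite ler_pdivrMr ?addr_gt0// ler_peMr//; last by rewrite lerDr ltW.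
apply: mulr_ge0; last exact: ltW hY0.
apply: mulr_ge0; last exact: ltW a0.
exact: mulr_ge0.
Qed.

End midpoint_defect.

(* Gamma 0 is undefined, so for alpha = 0 the left-hand side is read as its
   limit from the right. *)
Theorem theorem2p1 (R : realType) (B : R -> R)
    (hB : forall a, 0 <= a <= 1 -> B a != 0)
    (theta1 theta2 : R) (htheta : theta1 < theta2)
    (f f' : R -> R)
    (hf : is_derivative_on theta1 theta2 f f')
    (hL1 : lebesgue_measure.-integrable `[theta1, theta2] (EFin \o f'))
    (hconv : convex_function (`[theta1, theta2] : set R^o)
               (fun x => `|f' x|))
    (alpha : R) (halpha : 0 <= alpha <= 1) :
  let m := (theta1 + theta2) / 2 in
  let lhs := fun a : R =>
    `| (2 * (theta2 - theta1) `^ a + (1 - a) * 2 `^ (a + 1) * Gamma a)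
         / (theta2 - theta1) `^ (a + 1)
         * (f theta1 + f theta2 + 2 * f m)
       - 2 `^ (a + 1) * B a * Gamma a / (theta2 - theta1) `^ (a + 1)
         * (ABI_right B m a f theta1 + ABI_left B theta1 a f m
            + ABI_left B m a f theta2 + ABI_right B theta2 a f m) | in
  let rhs := 2 * (`|f' theta1| + `|f' theta2|) / (alpha + 1) in
  (0 < alpha -> lhs alpha <= rhs)
  /\ (alpha = 0 -> exists2 l : R, lhs a @[a --> 0^'+] --> l & l <= rhs).
Proof.
move=> m lhs rhs; have [alpha0 alpha1] := andP halpha.
split=> [alpha_gt0|alphaE].
  by apply: (lhs_le hB htheta hf hconv); rewrite ?alpha_gt0.
exists 0; last by rewrite /rhs divr_ge0 ?mulr_ge0 ?addr_ge0.
(* The limit is 0, squeezed below this linear bound. *)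
pose bound (a : R) : R := 4 * (`|f' theta1| + `|f' theta2|) * a.
have bound0 : bound a @[a --> 0^'+] --> 0.
  rewrite -[X in _ --> X](mulr0 (4 * (`|f' theta1| + `|f' theta2|))).
  by apply: cvgMr; apply: cvg_at_right_filter; exact: cvg_id.
apply: (@squeeze_cvgr _ _ _ _ (fun=> 0) bound) => //; last exact: cvg_cst.
near=> a; rewrite normr_ge0/=; apply: (lhs_le_small hB htheta hf hconv).
apply/andP; split; first by near: a; exact: nbhs_right_gt.
by near: a; exact: nbhs_right_le.
Unshelve. all: by end_near. Qed.
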